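(* For $y\in\mathbb{R}^+:=[0,\infty)$, the pressure function $p(y)=\lim_{n\to\infty}\frac{1}{4\cdot 3^n}\log|Z_n(y)|$ of the Ising model on the Sierpinski gasket is analytic, and $$\lim_{y\to\infty}\left|p(y)-\frac34\log y\right|=0 .$$
   Context: Sierpinski gasket graphs: $\mathcal{G}_0$ is a triangle (three vertices, three edges), whose three vertices are its external corners. For $n\ge 1$, $\mathcal{G}_n$ is obtained from three copies of $\mathcal{G}_{n-1}$ by joining them at their external corners: for each pair of copies, one external corner of one copy is identified with one external corner of the other, the three identifications using six distinct corners; the three remaining unidentified corners are the external corners of $\mathcal{G}_n$. Ising model: for a finite graph with vertex set $\mathcal{V}$ and edge set $\mathcal{E}$, a spin configuration is a map $\sigma:\mathcal{V}\to\{\pm1\}$; its Hamiltonian is $H(\sigma)=-J\sum_{\langle v,w\rangle\in\mathcal{E}}\sigma(v)\sigma(w)$ with $J>0$ constant (each edge counted once); its Gibbs weight is $W(\sigma)=e^{-H(\sigma)/T}$ with temperature $T>0$. Put $y=e^{J/T}$. The partition function $Z_n$ is the sum of $W(\sigma)$ over all spin configurations $\sigma$ on $\mathcal{G}_n$, written in terms of the variable $y$; equivalently $$Z_n(y)=\sum_{\sigma}y^{\sum_{\langle v,w\rangle}\sigma(v)\sigma(w)},$$ which is a rational function (Laurent polynomial) of $y$ and is regarded as a function of a complex variable $y$, i.e. as a map on the Riemann sphere. For example $Z_0(y)=2y^3+6y^{-1}$.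
   Formalization: At y=0 every Z_n has a pole, so p(0)=+∞ and p is not analytic there; analyticity is proved for all y>0, and at y=0 it is replaced by: p(0)=+∞ and p(y)+(1/4)log y agrees for small y>0 with a function analytic at 0. *)

(* Defs.v *)
From HB Require Import structures.
From mathcomp Require Import all_boot all_order all_algebra.
From mathcomp Require Import all_classical all_reals all_analysis.

Set Implicit Arguments.
Unset Strict Implicit.
Unset Printing Implicit Defensive.

Import Order.TTheory GRing.Theory Num.Theory numFieldNormedType.Exports.
Local Open Scope ring_scope.
Local Open Scope quotient_scope.

(* A finite simple graph, its edges being two-element vertex sets, with three
   external corners. *)
Record cgraph := CGraph {
  vertex : finType;
  edges : {set {set vertex}};
  corner : 'I_3 -> vertex }.

Definition triangle : cgraph :=
  @CGraph 'I_3 [set E : {set 'I_3} | #|E| == 2%N]%SET id.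

Section Join.
Variable G : cgraph.

(* The pair (i, v) is the vertex v of the i-th copy of G.  For i != j, corner j
   of copy i is identified with corner i of copy j, so that corner i of copy i
   is the one left free.  As G_n has automorphisms inducing every permutation
   of its corners, any other choice of the three identifications yields an
   isomorphic graph. *)
Definition glued (x y : 'I_3 * vertex G) : bool :=
  [&& x.1 != y.1, x.2 == corner G y.1 & y.2 == corner G x.1].

Definition glue : rel ('I_3 * vertex G) := connect glued.

Lemma glue_refl : reflexive glue.
Proof. by move=> x; exact: connect0. Qed.

Lemma glue_sym : symmetric glue.
Proof.
by apply: sym_connect_sym => x y; rewrite /glued eq_sym; congr andb; exact: andbC.
Qed.

Lemma glue_trans : transitive glue.
Proof. exact: connect_trans. Qed.

Canonical glue_equiv := EquivRel glue glue_refl glue_sym glue_trans.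

Definition joined_vertex : finType := quot_type {eq_quot glue_equiv}.

Definition in_copy (i : 'I_3) (v : vertex G) : joined_vertex :=
  \pi_{eq_quot glue_equiv} (i, v).

Definition join3 : cgraph :=
  @CGraph joined_vertex
    [set [set in_copy i v | v in E] | i : 'I_3, E : {set vertex G} in edges G]%SET
    (fun i => in_copy i (corner G i)).

End Join.

Definition gasket (n : nat) : cgraph := iter n join3 triangle.

Definition spin (b : bool) : int := (-1) ^+ b.

(* The sum over the edges <v, w> of sigma(v) sigma(w), i.e. - H(sigma) / J. *)
Definition interaction (G : cgraph) (sigma : {ffun vertex G -> bool}) : int :=
  \sum_(E in edges G) \prod_(v in E) spin (sigma v).

Definition Z (F : fieldType) (n : nat) (y : F) : F :=
  \sum_(sigma : {ffun vertex (gasket n) -> bool}) y ^ interaction sigma.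

Section Pressure.
Local Open Scope classical_set_scope.
Variable R : realType.

(* Modulus of Z_n as a map to the Riemann sphere.  The limit is `|Z n y| for
   y != 0; it is needed at y = 0, a pole of Z_n, where 0^-1 = 0 would otherwise
   make the expression `|Z n 0| meaningless. *)
Definition absZ (n : nat) (y : R) : \bar R :=
  lim ((`|Z n t|%:E : \bar R) @[t --> y^']).

Definition pressure_seq (y : R) : (\bar R)^nat :=
  fun n => (((4 * 3 ^+ n)^-1)%:E * lne (absZ n y))%E.

Definition pressure (y : R) : \bar R := limn (pressure_seq y).

Definition analytic_at (f : R -> R) (x0 : R) : Prop :=
  exists a : R^nat, \forall x \near x0, pseries a (x - x0) @ \oo --> f x.

End Pressure.

(* Main.v *)
(* Let a_n and b_n be the Gibbs sums over the configurations of G_n whose corner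
   spins are prescribed to be all equal, resp. not all equal.  Summing over the
   three glued vertices gives
     a_(n+1) = a^3 + 3 a b^2 + 4 b^3,   b_(n+1) = a^2 b + 4 a b^2 + 3 b^3,
   so that s = a / b - 1 obeys s' = s^2 / (s + 4), which converges to the
   superattracting fixed point 0 from every s_0 = y^4 - 1, and
   b_(n+1) = b_n^3 (s_n + 2) (s_n + 4).  Hence, after factoring out the pole at
   y = 0, the pressure is a series of terms 3^-(n+1) ln ((s_n + 2) (s_n + 4)).
   Once s_n is small at a point, the recursion keeps the weighted l^1 norms of
   the Taylor coefficients of all later s_n bounded by 1 near that point; the
   series then converges in this norm, which makes the sum analytic.
   At infinity, a_(n+1) >= a_n^3 and a_(n+1) + 3 b_(n+1) <= (a_n + 3 b_n)^3
   pinch the pressure between (3/4) ln y and (1/4) ln (y^3 + 3 / y). *)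
Require Import Defs.
From HB Require Import structures.
From mathcomp Require Import all_boot all_order all_algebra.
From mathcomp Require Import ring lra.
From mathcomp Require Import all_classical all_reals all_analysis.
Import Order.TTheory GRing.Theory Num.Theory numFieldNormedType.Exports.
Set Implicit Arguments.
Unset Strict Implicit.
Unset Printing Implicit Defensive.
Local Open Scope set_scope.
Local Open Scope ring_scope.

(** * Partition functions with prescribed corner spins *)

(** The invariant that makes joining behave well: distinct corners keep every glued class to at most
    two vertices, and two-element edges cannot lie in two copies at once. *)
Definition gasket_like (G : cgraph) : Prop :=
  injective (corner G) /\ forall E, E \in edges G -> #|E| = 2%N.

Section Join.
Context (G : cgraph) (HG : gasket_like G).

Let corner_inj : injective (corner G). Proof. exact: HG.1. Qed.

(** If [glued] leads from copy [i] to copy [j] and on to copy [k], injectivity of [corner] forces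
    [k = i] and the same vertex. So the transitive closure only adds reflexivity. *)
Lemma glueE (x y : 'I_3 * vertex G) : Defs.glue x y = (x == y) || glued x y.
Proof.
apply/idP/idP; last first.
  by case/orP=> [/eqP->|?]; [exact: connect0 | exact: connect1].
case/connectP=> p + ->; elim: p x => [|z p IHp] x /=; first by rewrite eqxx.
case/andP=> xz /IHp /orP[/eqP<-|]; first by rewrite xz orbT.
move: (last z p) => w {IHp}; case: x z w xz => [i v] [j u] [k w].
rewrite /glued /= => /and3P[ij /eqP-> /eqP->] /and3P[_ /eqP/corner_inj-> /eqP->].
by rewrite eqxx.
Qed.

Lemma in_copyP (i j : 'I_3) (v w : vertex G) :
  in_copy i v = in_copy j w <-> ((i, v) = (j, w) \/ glued (i, v) (j, w)).
Proof.
split.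
  by move=> /eqmodP; rewrite /= glueE => /orP[/eqP|]; [left|right].
by move=> H; apply/eqmodP; rewrite /= glueE; apply/orP;
   case: H => [->|->]; [left|right].
Qed.

Lemma in_copy_inj (i : 'I_3) : injective (@in_copy G i).
Proof. by move=> v w /in_copyP[[]//|]; rewrite /glued /= eqxx. Qed.

Lemma in_copy_corner (i j : 'I_3) :
  in_copy i (corner G j) = in_copy j (corner G i).
Proof.
have [->//|ij] := eqVneq i j.
by apply/in_copyP; right; rewrite /glued /= ij !eqxx.
Qed.

(** Two different copies share at most one vertex, whereas an edge has two ends. Hence no edge is
    merged with another and the energy is additive over the copies. *)
Lemma in_copy_edge_inj (i j : 'I_3) (E F : {set vertex G}) :
  E \in edges G -> in_copy i @: E = in_copy j @: F -> (i, E) = (j, F).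
Proof.
move=> /HG.2 /eqP/cards2P[v [w [vw ->]]] EF.
have [ij|ij] := eqVneq i j.
  by rewrite -ij in EF *; rewrite (imset_inj (@in_copy_inj i) EF).
have to_corner x : x \in [set v; w] -> x = corner G j.
  move=> /(imset_f (in_copy i)); rewrite EF => /imsetP[u _ /in_copyP[[] ij'|]].
    by rewrite ij' eqxx in ij.
  by rewrite /glued /= => /and3P[_ /eqP-> _].
have := vw; rewrite (to_corner v) ?set21// (to_corner w) ?set22//.
by rewrite eqxx.
Qed.

Lemma gasket_like_join3 : gasket_like (join3 G).
Proof.
split=> [i j /in_copyP[[]//|]|E].
  by rewrite /glued /= => /and3P[_ /eqP/corner_inj->].
case/imset2P=> i F _ FG ->; rewrite card_imset; last exact: in_copy_inj.
by rewrite HG.2.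
Qed.

Definition restrict (sigma : {ffun vertex (join3 G) -> bool}) :
    {ffun 'I_3 -> {ffun vertex G -> bool}} :=
  [ffun i => [ffun v => sigma (in_copy i v)]].

(** The value is read off at the canonical representative of each glued class, so this inverts
    [restrict] only on families that agree at the glued corners. *)
Definition combine (phi : {ffun 'I_3 -> {ffun vertex G -> bool}}) :
    {ffun vertex (join3 G) -> bool} :=
  [ffun x : joined_vertex G => phi (repr x).1 (repr x).2].

Lemma restrictK : cancel restrict combine.
Proof.
move=> sigma; apply/ffunP => x; rewrite !ffunE /in_copy.
by rewrite -surjective_pairing reprK.
Qed.

Lemma combineK (phi : {ffun 'I_3 -> {ffun vertex G -> bool}}) :
  (forall i j, phi i (corner G j) = phi j (corner G i)) ->
  restrict (combine phi) = phi.
Proof.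
move=> sym; apply/ffunP => i; apply/ffunP => v; rewrite !ffunE.
have : in_copy (repr (in_copy i v)).1 (repr (in_copy i v)).2 = in_copy i v.
  by rewrite [LHS]/in_copy -surjective_pairing reprK.
case: (repr _) => j w /= /in_copyP[[-> ->]//|].
by rewrite /glued /= => /and3P[_ /eqP-> /eqP->].
Qed.

Lemma interaction_join3 sigma :
  interaction (G := join3 G) sigma = \sum_(i < 3) interaction (restrict sigma i).
Proof.
rewrite /interaction.
have -> : edges (join3 G) =
    [set in_copy p.1 @: p.2 | p : 'I_3 * {set vertex G} in
      [set p : 'I_3 * {set vertex G} | p.2 \in edges G]].
  apply/setP => E; apply/imset2P/imsetP => [[i F _ FG ->]|[[i F]]].
    by exists (i, F); rewrite ?inE.
  by rewrite inE => FG ->; exists i F.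
rewrite big_imset /=; last first.
  move=> [i E] [j F]; rewrite !inE /= => EG FG.
  exact: in_copy_edge_inj.
rewrite [RHS](pair_big xpredT (fun E => E \in edges G)
  (fun i E => \prod_(v in E) spin (restrict sigma i v))) /=.
apply: eq_big => [[i E]|[i E] _]; first by rewrite !inE.
rewrite -[RHS](_ : \prod_(v in E) spin (sigma (in_copy i v)) = _); last first.
  by apply: eq_bigr => v _; rewrite !ffunE.
exact: (big_imset (fun v : vertex (join3 G) => spin (sigma v))
  (in2W (@in_copy_inj i))).
Qed.

End Join.

(** * Sums over configurations with fixed corner spins *)

Section Partial.
Variables (F : fieldType) (y : F).
Hypothesis y0 : y != 0.

Definition has_corners (G : cgraph) (tau : 'I_3 -> bool)
    (sigma : {ffun vertex G -> bool}) : bool :=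
  [forall i, sigma (corner G i) == tau i].

Definition Zpart (G : cgraph) (tau : 'I_3 -> bool) : F :=
  \sum_(sigma : {ffun vertex G -> bool} | has_corners tau sigma)
    y ^ interaction sigma.

Lemma expfz_sum (I : finType) (f : I -> int) :
  y ^ (\sum_i f i) = \prod_i y ^ f i.
Proof.
by apply: (big_ind2 (fun m x => y ^ m = x)) => // m x n z <- <-; rewrite expfzDr.
Qed.

(** Symmetry of [mu] says that glued corners carry the same spin. With these spins fixed, a
    configuration of the join is an arbitrary triple of configurations of the copies, and the sum
    factors. *)
Lemma Zpart_join3_inner G (mu : 'I_3 -> 'I_3 -> bool) : gasket_like G ->
  (forall i j, mu i j = mu j i) ->
  \sum_(sigma : {ffun vertex (join3 G) -> bool} |
      [forall i, has_corners (mu i) (restrict sigma i)]) y ^ interaction sigma =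
  \prod_i Zpart G (mu i).
Proof.
move=> HG mu_sym; rewrite /Zpart.
rewrite (bigA_distr_big_dep
  (fun i (sigma : {ffun vertex G -> bool}) => has_corners (mu i) sigma)
  (fun i sigma => y ^ interaction sigma)) /=.
rewrite (reindex_onto (@combine G) (@restrict G)) /=; last first.
  by move=> sigma _; exact: restrictK.
have fam (phi : {ffun 'I_3 -> {ffun vertex G -> bool}}) :
    phi \in family (fun i => has_corners (mu i)) ->
    restrict (combine phi) = phi.
  move=> /familyP phiP; apply: (combineK HG) => i j.
  have := phiP i => /forallP/(_ j)/eqP->.
  by have := phiP j => /forallP/(_ i)/eqP->.
apply: eq_big => [phi|phi /andP[_ /eqP phiK]].
  apply/idP/idP => [/andP[/forallP P /eqP phiK]|phiP].
    by apply/familyP => i; have := P i; rewrite phiK.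
  by rewrite fam // eqxx andbT; apply/forallP => i; have /familyP := phiP; exact.
by rewrite (interaction_join3 HG) phiK expfz_sum.
Qed.


(** The third component is the default value of [nth], so index 2 reads it past the end of the
    list. *)
Definition triple (T : Type) (t : T * T * T) (i : 'I_3) : T :=
  nth t.2 [:: t.1.1; t.1.2] i.

(** The spin at corner [j] of copy [i]: the free corner has [i = j], and the glued pairs {0,1},
    {0,2}, {1,2} are numbered 0, 1, 2 by [i + j - 1]. *)
Definition corner_spins (tau : 'I_3 -> bool) (t : bool * bool * bool)
    (i j : 'I_3) : bool :=
  if i == j then tau i else triple t (inord (i + j).-1).

Lemma forall_I3 (P : 'I_3 -> Prop) :
  P ord0 -> P (inord 1) -> P (inord 2) -> forall i, P i.
Proof.
move=> P0 P1 P2 [[|[|[|//]]] i3].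
- by rewrite (_ : Ordinal i3 = ord0) //; apply: val_inj.
- by rewrite (_ : Ordinal i3 = inord 1) //; apply: val_inj; rewrite /= inordK.
- by rewrite (_ : Ordinal i3 = inord 2) //; apply: val_inj; rewrite /= inordK.
Qed.

Lemma big_I3 (R : Type) (idx : R) (op : Monoid.law idx) (f : 'I_3 -> R) :
  \big[op/idx]_i f i = op (f ord0) (op (f (inord 1)) (f (inord 2))).
Proof.
rewrite !big_ord_recl big_ord0 Monoid.mulm1.
rewrite (_ : lift ord0 ord0 = inord 1); last by apply: val_inj; rewrite /= inordK.
by rewrite (_ : lift ord0 _ = inord 2) //; apply: val_inj; rewrite /= inordK.
Qed.

Lemma Zpart_join3 G (tau : 'I_3 -> bool) : gasket_like G ->
  Zpart (join3 G) tau =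
  \sum_(t : bool * bool * bool) \prod_i Zpart G (corner_spins tau t i).
Proof.
move=> HG; rewrite [LHS](partition_big (fun sigma =>
  (restrict sigma ord0 (corner G (inord 1)),
   restrict sigma ord0 (corner G (inord 2)),
   restrict sigma (inord 1) (corner G (inord 2)))) xpredT) //=.
apply: eq_bigr => t _; rewrite -Zpart_join3_inner //; last first.
  by move=> i j; rewrite /corner_spins eq_sym addnC; case: eqP => [->|].
apply: eq_bigl => sigma; apply/andP/forallP.
  move=> [/forallP Ht /eqP <-] i; apply/forallP => j; apply/eqP.
  have E k : sigma (in_copy k (corner G k)) = tau k by exact/eqP/Ht.
  rewrite /corner_spins; have [<-|] := eqVneq i j; first by rewrite !ffunE.
  move: i j; apply: forall_I3; apply: forall_I3; rewrite ?eqxx //= => _;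
    rewrite /triple ?inordK //= ?inordK //= !ffunE //; by rewrite in_copy_corner.
move=> H; have {}H i j : restrict sigma i (corner G j) = corner_spins tau t i j.
  exact/eqP/(forallP (H i)).
split.
  by apply/forallP => i; have := H i i; rewrite !ffunE /corner_spins eqxx => ->.
rewrite !H /corner_spins /triple -!val_eqE /= !inordK //=.
by case: t {H} => -[].
Qed.


Lemma Zpart_triangle (tau : 'I_3 -> bool) :
  Zpart triangle tau = if (tau ord0 == tau (inord 1)) && (tau ord0 == tau (inord 2))
    then y ^+ 3 else y^-1.
Proof.
rewrite /Zpart (big_pred1 [ffun i => tau i]); last first.
  move=> sigma; apply/forallP/eqP => [H|-> i]; last by rewrite ffunE.
  by apply/ffunP => i; rewrite ffunE; apply/eqP/H.
have -> : @interaction triangle [ffun i => tau i] =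
    \sum_(i : 'I_3) \prod_(j : 'I_3 | j != i) spin (tau j).
  rewrite /interaction.
  (* Each edge of the triangle is the complement of the opposite vertex. *)
  have -> : edges triangle = [set [set~ i] | i : 'I_3].
    apply/setP => E; rewrite inE; apply/idP/imsetP => [|[i _ ->]]; last first.
      by rewrite cardsC1 card_ord.
    move=> /eqP E2; have : #|~: E| == 1%N by rewrite cardsCs finset.setCK E2 card_ord.
    by case/cards1P => i Ei; exists i => //; rewrite -Ei finset.setCK.
  rewrite big_imset /=; last by move=> i j _ _ /finset.setC_inj/finset.set1_inj.
  by apply: eq_bigr => i _; apply: eq_big => [j|j _]; rewrite ?inE // ffunE.
under eq_bigr do rewrite big_mkcond big_I3 /=.
rewrite big_I3 -!val_eqE /= !inordK //=.
by case: (tau ord0); case: (tau (inord 1)); case: (tau (inord 2)).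
Qed.

End Partial.

(** The pair (a_n, b_n) multiplied by y^(3^n), for x = y^4. This removes the pole at 0: the starting
    pair (y^3, y^-1) becomes (y^4, 1), and every later weight is a polynomial in x. *)
Fixpoint corner_weights (R : pzSemiRingType) (x : R) (n : nat) : R * R :=
  if n is m.+1 then
    let: (a, b) := corner_weights x m in
    (a ^+ 3 + 3 * a * b ^+ 2 + 4 * b ^+ 3, a ^+ 2 * b + 4 * a * b ^+ 2 + 3 * b ^+ 3)
  else (x, 1).

Lemma gasket_like_gasket n : gasket_like (gasket n).
Proof.
elim: n => [|n IH]; last exact: gasket_like_join3.
by split=> [|E]; [exact: inj_id | rewrite inE => /eqP].
Qed.

Lemma sum_bool3 (V : nmodType) (f : bool * bool * bool -> V) :
  \sum_t f t = \sum_p \sum_q \sum_r f (p, q, r).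
Proof.
rewrite pair_bigA (pair_bigA _ (fun pq r => f (pq.1, pq.2, r))) /=.
by apply: eq_bigr => -[[p q] r].
Qed.

Section Z.
Variables (F : fieldType) (y : F).
Hypothesis y0 : y != 0.

(** Only whether the corner spins all agree matters; for each of the eight choices of [tau] the sum
    over the three glued spins reduces to the recursion. Cubing the prefactor turns 3^n into
    3^(n+1). *)
Lemma Zpart_gasket n (tau : 'I_3 -> bool) :
  Zpart y (gasket n) tau = y ^- (3 ^ n) *
    if (tau ord0 == tau (inord 1)) && (tau ord0 == tau (inord 2))
    then (corner_weights (y ^+ 4) n).1 else (corner_weights (y ^+ 4) n).2.
Proof.
elim: n tau => [|n IHn] tau.
  by rewrite Zpart_triangle /= expn0 expr1; case: ifP => _; field.
rewrite (Zpart_join3 y0 _ (gasket_like_gasket n)).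
under eq_bigr do under eq_bigr do rewrite IHn.
rewrite expnSr exprM -!exprVn; set u := y^-1 ^+ (3 ^ n).
under eq_bigr do rewrite big_I3.
rewrite sum_bool3 !big_bool /=.
rewrite /corner_spins /triple -!val_eqE /=.
rewrite (@inordK 2 1) // (@inordK 2 2) // !eqxx /= !inordK //=.
case: (corner_weights _ _) => a b.
by case: (tau ord0); case: (tau (inord 1)); case: (tau (inord 2)); rewrite /=; ring.
Qed.

(** Of the eight choices of corner spins, two are constant and six are not. *)
Lemma Z_corner_weights n : Z n y = 2 * y ^- (3 ^ n) *
  ((corner_weights (y ^+ 4) n).1 + 3 * (corner_weights (y ^+ 4) n).2).
Proof.
transitivity (\sum_(t : bool * bool * bool) Zpart y (gasket n) (triple t)).
  rewrite /Z (partition_big (fun sigma : {ffun vertex (gasket n) -> bool} =>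
    (sigma (corner (gasket n) ord0),
     sigma (corner (gasket n) (inord 1)), sigma (corner (gasket n) (inord 2))))
     xpredT) //=.
  apply: eq_bigr => t _; apply: eq_bigl => sigma.
  apply/eqP/forallP => [<-|H].
    by apply: forall_I3; rewrite /triple /= ?inordK.
  rewrite (eqP (H ord0)) (eqP (H (inord 1))) (eqP (H (inord 2))).
  by rewrite /triple /= !inordK //=; case: t {H} => -[].
under eq_bigr do rewrite Zpart_gasket /triple /= !inordK //=.
rewrite sum_bool3 !big_bool /=.
by ring.
Qed.

End Z.

Close Scope set_scope.
Local Open Scope classical_set_scope.
Local Open Scope ring_scope.

(** * Power series with summable weighted coefficients *)

Section Wiener.
Context {R : realType}.
Implicit Types (F G : R -> R) (a : R^nat) (rho M h : R).

(* [F] is a power series whose coefficients have weighted l^1 norm at most [M];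
   for fixed [rho] these functions form a Banach algebra. *)
Definition wiener F rho M := 0 < rho /\ exists a,
  (forall n, series (fun k => `|a k| * rho ^+ k) n <= M) /\
  (forall h, `|h| <= rho -> pseries a h @ \oo --> F h).

Lemma cvg_norm_le (u : R^nat) l M :
  u @ \oo --> l -> (\forall n \near \oo, `|u n| <= M) -> `|l| <= M.
Proof. by move=> ul uM; apply: (ler_cvg_to (cvg_norm ul) (cvg_cst M)). Qed.

Lemma cvg_sum_seq (u : nat -> R^nat) (l : R^nat) n :
  (forall k, u k @ \oo --> l k) ->
  \sum_(0 <= k < n) u k j @[j --> \oo] --> \sum_(0 <= k < n) l k.
Proof. by move=> ul; apply: cvg_big => //; exact: add_continuous. Qed.

Lemma norm_pseries_le a rho h n : `|h| <= rho ->
  `|pseries a h n| <= series (fun k => `|a k| * rho ^+ k) n.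
Proof.
move=> hrho; apply: le_trans (ler_norm_sum _ _ _) _; apply: ler_sum => k _.
by rewrite normrM normrX ler_wpM2l // lerXn2r // nnegrE // (le_trans _ hrho).
Qed.

Lemma wiener_norm_le F rho M h : wiener F rho M -> `|h| <= rho -> `|F h| <= M.
Proof.
move=> [_ [a [aM aF]]] hrho; apply: (cvg_norm_le (aF h hrho)); apply: nearW => n.
exact: le_trans (norm_pseries_le _ _ hrho) (aM n).
Qed.

Lemma wiener_ge0 F rho M : wiener F rho M -> 0 <= M.
Proof. by move=> [_ [a [aM _]]]; have := aM 0%N; rewrite /series /= big_geq. Qed.

Lemma eq_wiener F G rho M : (forall h, `|h| <= rho -> F h = G h) ->
  wiener F rho M -> wiener G rho M.
Proof.
move=> FG [rho0 [a [aM aF]]]; split=> //; exists a; split=> // h hrho.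
by rewrite -FG //; exact: aF.
Qed.

Lemma wiener_le F rho rho' M M' : 0 < rho' -> rho' <= rho -> M <= M' ->
  wiener F rho M -> wiener F rho' M'.
Proof.
move=> rho'0 rho'rho MM' [_ [a [aM aF]]]; split=> //; exists a.
split=> [n|h hrho]; last by apply: aF; exact: le_trans rho'rho.
apply: le_trans MM'; apply: le_trans (aM n); apply: ler_sum => k _.
by rewrite ler_wpM2l // lerXn2r // nnegrE ltW // (lt_le_trans _ rho'rho).
Qed.

Lemma wiener_cst c rho : 0 < rho -> wiener (fun=> c) rho `|c|.
Proof.
move=> rho0; split=> //; exists (fun k => if k == 0%N then c else 0).
split=> [[|n]|h _].
- by rewrite /series /= big_geq.
- rewrite /series /= big_nat_recl //= expr0 mulr1 big1 ?addr0 // => i _.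
  by rewrite normr0 mul0r.
(* The partial sum of length 0 is empty; the value [c] is reached from length 1 on. *)
rewrite -(cvg_shiftn 1) /=; apply: cvg_near_cst; apply: nearW => n.
rewrite /pseries /series /= addn1 big_nat_recl //= expr0 mulr1 big1 ?addr0 // => i _.
by rewrite mul0r.
Qed.

Lemma wienerXM F rho M : wiener F rho M -> wiener (fun h => h * F h) rho (rho * M).
Proof.
move=> WF; have M0 := wiener_ge0 WF; have [rho0 [a [aM aF]]] := WF.
split=> //; exists (fun k => if k is j.+1 then a j else 0); split=> [[|n]|h hrho].
- by rewrite /series /= big_geq // mulr_ge0 // ltW.
- rewrite /series /= big_nat_recl //= normr0 mul0r add0r.
  rewrite (eq_bigr (fun k => rho * (`|a k| * rho ^+ k))); last first.
    by move=> k _; rewrite exprS; ring.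
  by rewrite -mulr_sumr ler_wpM2l ?(ltW rho0) //; exact: aM.
rewrite -(cvg_shiftn 1) /=.
rewrite (_ : (fun _ => _) = (fun n => h * pseries a h n)).
  by apply: cvgM; [exact: cvg_cst | exact: aF].
apply/funext => n; rewrite /pseries /series /= addn1 big_nat_recl //= mul0r add0r.
by rewrite mulr_sumr; apply: eq_bigr => k _; rewrite exprS; ring.
Qed.

Lemma wienerD F G rho M N : wiener F rho M -> wiener G rho N ->
  wiener (fun h => F h + G h) rho (M + N).
Proof.
move=> [rho0 [a [aM aF]]] [_ [b [bN bG]]]; split=> //; exists (a \+ b).
split=> [n|h hrho].
  apply: le_trans (lerD (aM n) (bN n)); rewrite -big_split /=.
  apply: ler_sum => k _; rewrite -mulrDl ler_wpM2r ?ler_normD //.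
  by rewrite exprn_ge0 // ltW.
rewrite (_ : pseries _ _ = pseries a h \+ pseries b h).
  by apply: cvgD; [exact: aF|exact: bG].
apply/funext => n; rewrite /pseries /series /= -big_split /=.
by apply: eq_bigr => k _; rewrite mulrDl.
Qed.

Lemma wienerZ c F rho M : wiener F rho M -> wiener (fun h => c * F h) rho (`|c| * M).
Proof.
move=> [rho0 [a [aM aF]]]; split=> //; exists (fun k => c * a k).
split=> [n|h hrho].
  rewrite /series /= (eq_bigr (fun k => `|c| * (`|a k| * rho ^+ k))); last first.
    by move=> k _; rewrite normrM mulrA.
  by rewrite -mulr_sumr ler_wpM2l //; exact: aM.
rewrite (_ : pseries _ _ = fun n => c * pseries a h n).
  by apply: cvgM; [exact: cvg_cst|exact: aF].
apply/funext => n; rewrite /pseries /series /= mulr_sumr.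
by apply: eq_bigr => k _; rewrite mulrA.
Qed.

Lemma series_tail (M : R^nat) N : (forall j, 0 <= M j) -> (forall n, series M n <= N) ->
  forall e, 0 < e -> exists J, forall i, (J <= i)%N -> \sum_(J <= j < i) M j <= e.
Proof.
move=> M0 MN e e0.
have ndM : nondecreasing_seq (series M) by exact: nondecreasing_series.
have cM : cvgn (series M).
  by apply: nondecreasing_is_cvgn => //; exists N => _ [n _ <-].
have /cvgrPdist_le/(_ e e0)[J _ HJ] := cM; exists J => i Ji.
rewrite -sub_series_geq //; have := HJ J (leqnn J); have := HJ i Ji.
have := nondecreasing_cvgn_le ndM cM i; have := nondecreasing_cvgn_le ndM cM J.
move=> h1 h2; rewrite !ger0_norm ?subr_ge0 //; lra.
Qed.

(* Completeness of the l^1 norm; the interchange of the two summations is the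
   dominated convergence of series. *)
Lemma wiener_series (F : nat -> R -> R) (M : R^nat) G rho N : 0 < rho ->
  (forall j, wiener (F j) rho (M j)) -> (forall n, series M n <= N) ->
  (forall h, `|h| <= rho -> series (fun j => F j h) @ \oo --> G h) ->
  wiener G rho N.
Proof.
move=> rho0 WF MN FG; have M0 j := wiener_ge0 (WF j).
have /choice[b bP] j : exists a,
  (forall n, series (fun k => `|a k| * rho ^+ k) n <= M j) /\
  (forall h, `|h| <= rho -> pseries a h @ \oo --> F j h) by have [] := WF j.
have rhoX k : 0 <= rho ^+ k by rewrite exprn_ge0 // ltW.
(* The k-th coefficient of [F j] is at most [M j / rho ^+ k], so these coefficients are absolutely
   summable over [j]. *)
have cb k : cvgn (series (fun j => b j k)).
  apply: normed_cvg; apply: nondecreasing_is_cvgn.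
    apply: (@nondecreasing_series _ (fun j => `|b j k|) xpredT 0) => j _ _.
    exact: normr_ge0.
  exists (N / rho ^+ k) => _ [n _ <-]; rewrite ler_pdivlMr ?exprn_gt0 //.
  apply: le_trans (MN n); rewrite /series /= mulr_suml; apply: ler_sum => j _.
  have := (bP j).1 k.+1; rewrite /series /= big_nat_recr //=; apply: le_trans.
  by rewrite lerDr sumr_ge0 // => i _; rewrite mulr_ge0.
pose c k := limn (series (fun j => b j k)).
have cP k : series (fun j => b j k) @ \oo --> c k by exact: cb.
(* The weighted distance from [c] to the coefficients of the J-th partial sum is bounded by the tail
   of [M]: for finitely many [k] the limit in [i] is taken termwise. *)
have cT J e n : (forall i, (J <= i)%N -> \sum_(J <= j < i) M j <= e) ->
    \sum_(0 <= k < n) `|c k - series (fun j => b j k) J| * rho ^+ k <= e.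
  move=> He.
  have cvT : \sum_(0 <= k < n) `|series (fun j => b j k) i - series (fun j => b j k) J|
      * rho ^+ k @[i --> \oo] -->
      \sum_(0 <= k < n) `|c k - series (fun j => b j k) J| * rho ^+ k.
    apply: (@cvg_sum_seq (fun k i => `|series (fun j => b j k) i -
       series (fun j => b j k) J| * rho ^+ k)) => k.
    apply: cvgM; last exact: cvg_cst.
    by apply: cvg_norm; apply: cvgB; [exact: cP | exact: cvg_cst].
  apply: (ler_cvg_to cvT (cvg_cst e)); exists J => // i /= Ji.
  apply: le_trans (He i Ji).
  apply: (@le_trans _ _ (\sum_(0 <= k < n) \sum_(J <= j < i) `|b j k| * rho ^+ k)).
    apply: ler_sum => k _; rewrite sub_series_geq // -mulr_suml ler_wpM2r //.
    exact: ler_norm_sum.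
  by rewrite exchange_big /=; apply: ler_sum => j _; exact: (bP j).1.
split=> //; exists c; split=> [n|h hrho].
  have /(cT 0%N N n) : forall i, (0 <= i)%N -> \sum_(0 <= j < i) M j <= N.
    by move=> i _; exact: MN.
  by under eq_bigr do rewrite [series _ 0]/series /= big_geq // subr0.
apply/cvgrPdist_le => e e0; have e3 : 0 < e / 3 by lra.
have [J HJ] := series_tail M0 MN e3.
(* Three errors of size e/3: from [G h] to the J-th partial sum, from there to its truncated power
   series, and from there to the truncated series of [c]. *)
have GJ : `|G h - series (fun j => F j h) J| <= e / 3.
  apply: (@cvg_norm_le (fun i => series (fun j => F j h) i - series (fun j => F j h) J)).
    by apply: cvgB; [exact: FG | exact: cvg_cst].
  exists J => // i /= Ji; apply: le_trans (HJ i Ji); rewrite sub_series_geq //.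
  apply: le_trans (ler_norm_sum _ _ _) _; apply: ler_sum => j _.
  exact: wiener_norm_le (WF j) hrho.
have FJ : \sum_(0 <= j < J) pseries (b j) h n @[n --> \oo] --> series (fun j => F j h) J.
  by apply: cvg_sum_seq => j; exact: (bP j).2.
move/cvgrPdist_le/(_ _ e3): FJ; apply: filterS => n Hn.
have Hc : `|\sum_(0 <= j < J) pseries (b j) h n - pseries c h n| <= e / 3.
  rewrite distrC; apply: le_trans (cT J _ n HJ).
  have -> : pseries c h n - \sum_(0 <= j < J) pseries (b j) h n =
      pseries (fun k => c k - series (fun j => b j k) J) h n.
    rewrite /pseries /series /= exchange_big /= -sumrB; apply: eq_bigr => k _.
    by rewrite mulrBl mulr_suml.
  exact: norm_pseries_le.
have -> : G h - pseries c h n = (G h - series (fun j => F j h) J) +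
  (series (fun j => F j h) J - \sum_(0 <= j < J) pseries (b j) h n) +
  (\sum_(0 <= j < J) pseries (b j) h n - pseries c h n) by ring.
apply: le_trans (ler_normD _ _) _.
have := ler_normD (G h - series (fun j => F j h) J)
  (series (fun j => F j h) J - \sum_(0 <= j < J) pseries (b j) h n); lra.
Qed.

Lemma wienerXnM F rho M k : wiener F rho M ->
  wiener (fun h => h ^+ k * F h) rho (rho ^+ k * M).
Proof.
move=> WF; elim: k => [|k IHk].
  by rewrite expr0 mul1r; apply: eq_wiener WF => h _; rewrite mul1r.
rewrite exprS -mulrA; apply: eq_wiener (wienerXM IHk) => h _.
by rewrite exprS mulrA.
Qed.

(** The product is the series over [k] of [a k * h ^+ k * G h], so completeness replaces the Cauchy
    product. *)
Lemma wienerM F G rho M N : wiener F rho M -> wiener G rho N ->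
  wiener (fun h => F h * G h) rho (M * N).
Proof.
move=> [rho0 [a [aM aF]]] WG.
apply: (@wiener_series (fun k h => a k * (h ^+ k * G h))
  (fun k => `|a k| * (rho ^+ k * N))) => // [k|n|h hrho].
- exact/wienerZ/wienerXnM.
- rewrite /series /= (eq_bigr (fun k => `|a k| * rho ^+ k * N)); last first.
    by move=> k _; rewrite mulrA.
  by rewrite -mulr_suml ler_wpM2r ?(wiener_ge0 WG) //; exact: aM.
rewrite (_ : series _ = fun n => pseries a h n * G h).
  by apply: cvgM; [exact: aF|exact: cvg_cst].
apply/funext => n; rewrite /pseries /series /= mulr_suml.
by apply: eq_bigr => k _; rewrite mulrA.
Qed.

Lemma wiener_exp F rho M k : wiener F rho M -> wiener (fun h => F h ^+ k) rho (M ^+ k).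
Proof.
move=> WF; elim: k => [|k IHk]; last first.
  by rewrite exprS; apply: eq_wiener (wienerM WF IHk) => h _; rewrite exprS.
have rho0 : 0 < rho by case: WF.
rewrite expr0 -(@normr1 R); apply: eq_wiener (wiener_cst 1 rho0) => h _.
by rewrite expr0.
Qed.

Lemma geometric_series_le (c M : R) n : 0 <= c -> 0 <= M < 1 ->
  series (geometric c M) n <= c / (1 - M).
Proof.
move=> c0 /andP[M0 M1]; have M1' : `|M| < 1 by rewrite ger0_norm.
have cM := @cvg_geometric_series R c M M1'.
rewrite -(cvg_lim _ cM) //; apply: nondecreasing_cvgn_le; last exact: cvgP cM.
by apply: nondecreasing_series => k _ _; rewrite /geometric /= mulr_ge0 ?exprn_ge0.
Qed.

(** The Neumann series. *)
Lemma wiener_div1 F rho M : wiener F rho M -> M < 1 ->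
  wiener (fun h => (1 - F h)^-1) rho (1 - M)^-1.
Proof.
move=> WF M1; have M0 := wiener_ge0 WF; have rho0 : 0 < rho by case: WF.
have geoE (x : R) : (fun k => x ^+ k) = geometric 1 x.
  by apply/funext => k; rewrite /geometric /= mul1r.
apply: (@wiener_series (fun k h => F h ^+ k) (fun k => M ^+ k)) => // [k|n|h hrho].
- exact: wiener_exp.
- by rewrite geoE -div1r geometric_series_le // M0.
- have Fh : `|F h| < 1 by exact: le_lt_trans (wiener_norm_le WF hrho) M1.
  by rewrite geoE -[X in _ --> X]mul1r; exact: cvg_geometric_series.
Qed.

(** * The logarithm series *)

Lemma is_derive_ln1D_remainder (u t : R) n : 0 < 1 + t * u ->
  is_derive t 1 (fun s => ln (1 + s * u) -
      series (fun k => (-1) ^+ k * (s * u) ^+ k.+1 / k.+1%:R) n)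
    (u * ((- (t * u)) ^+ n / (1 + t * u))).
Proof.
move=> tu0; elim: n => [|n IHn].
  rewrite (_ : (fun s => _) = @ln R \o (fun s => 1 + s * u)); last first.
    by apply/funext => s; rewrite /series /= big_geq // subr0.
  rewrite expr0 mul1r mulrC; apply: is_derive1_comp; first exact: is_derive1_ln.
  apply: is_derive_eq; rewrite add0r mul1r scaler0 add0r; exact: mulr1.
rewrite (_ : (fun s => _) = (fun s => ln (1 + s * u) -
    series (fun k => (-1) ^+ k * (s * u) ^+ k.+1 / k.+1%:R) n) -
    (fun s => ((-1) ^+ n * u ^+ n.+1 / n.+1%:R) * s ^+ n.+1)); last first.
  apply/funext => s; rewrite /series /= big_nat_recr //= fctE opprD addrA exprMn.
  by congr (_ - _); ring.
have D (c : R) : is_derive t 1 (fun s : R => c * s ^+ n.+1) (c * (n.+1%:R * t ^+ n)).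
  have D := is_deriveZ c (is_deriveX n.+1 (is_derive_id t 1)).
  rewrite (_ : (fun s => _) = c \*: (id ^+ n.+1)); last first.
    by apply/funext => s; rewrite /= fctE.
  by apply: (is_derive_eq D); rewrite /= [X in _ *: X]mulr1.
apply: (is_derive_eq (is_deriveB IHn (D _))).
have n0 : n.+1%:R != 0 :> R by rewrite pnatr_eq0.
move: (n.+1%:R) n0 => N N0; have := lt0r_neq0 tu0;
rewrite !exprS -[- (t * u)]mulN1r !exprMn => tu1; field.
by rewrite N0 tu1.
Qed.

(** The mean value theorem is applied in the parameter [s] on [0, 1], along the segment from 0 to
    [u], which treats both signs of [u] alike. The denominator stays at least [1 - |u|]. *)
Lemma ln1D_remainder_le (u : R) n : `|u| < 1 ->
  `|ln (1 + u) - series (fun k => (-1) ^+ k * u ^+ k.+1 / k.+1%:R) n| <=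
  `|u| ^+ n.+1 / (1 - `|u|).
Proof.
move=> u1; pose f (s : R) := ln (1 + s * u) -
      series (fun k => (-1) ^+ k * (s * u) ^+ k.+1 / k.+1%:R) n.
have pos (t : R) : 0 <= t <= 1 -> 0 < 1 - `|u| <= 1 + t * u.
  move=> /andP[t0 t1]; rewrite subr_gt0 u1 /= lerD2l lerNl.
  apply: le_trans (ler_norm _) _; rewrite normrN normrM (ger0_norm t0).
  by rewrite ler_piMl.
have der (t : R) : 0 <= t <= 1 ->
    is_derive t 1 f (u * ((- (t * u)) ^+ n / (1 + t * u))).
  move=> /pos/andP[u1' tu]; apply: is_derive_ln1D_remainder.
  exact: lt_le_trans tu.
have [|c cI] := @MVT_segment R f _ 0 1 ler01
    (fun t tI => der t (subset_itv_oo_cc tI)).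
  apply: derivable_within_continuous => t; rewrite in_itv /= => t01.
  by apply: ex_derive; exact: der.
move: cI; rewrite in_itv /= => c01; have /andP[u1' cu] := pos c c01.
have cu0 : 0 < 1 + c * u := lt_le_trans u1' cu.
have -> : f 0 = 0.
  rewrite /f mul0r addr0 ln1 sub0r /series /= big1 ?oppr0 // => k _.
  by rewrite expr0n mulr0 mul0r.
rewrite subr0 /f mul1r => ->.
rewrite subr0 mulr1 !normrM normrX normfV normrN normrM.
have /andP[c0 c1] := c01.
rewrite mulrA exprS -mulrA -[leRHS]mulrA ler_wpM2l // ler_pM //.
- by rewrite lerXn2r ?nnegrE ?mulr_ge0 // ger0_norm // ler_piMl.
by rewrite gtr0_norm // lef_pV2.
Qed.

Lemma cvg_ln1D_series (u : R) : `|u| < 1 ->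
  series (fun k => (-1) ^+ k * u ^+ k.+1 / k.+1%:R) @ \oo --> ln (1 + u).
Proof.
move=> u1; apply/cvgrPdist_le => e e0.
have u1' : 0 < 1 - `|u| by rewrite subr_gt0.
have u2 : `|(`|u|)| < 1 by rewrite normr_id.
move: u2 => /cvg_expr/cvgrPdist_le/(_ (e * (1 - `|u|)) (mulr_gt0 e0 u1')).
apply: filterS => n; rewrite sub0r normrN ger0_norm ?exprn_ge0 // => Hn.
apply: le_trans (ln1D_remainder_le _ u1) _; rewrite ler_pdivrMr // exprS.
by apply: le_trans Hn; rewrite ler_piMl ?exprn_ge0 // ltW.
Qed.

Lemma wiener_ln1D F rho M : wiener F rho M -> M < 1 ->
  wiener (fun h => ln (1 + F h)) rho (M / (1 - M)).
Proof.
move=> WF M1; have M0 := wiener_ge0 WF; have rho0 : 0 < rho by case: WF.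
apply: (@wiener_series (fun k h => (-1) ^+ k / k.+1%:R * F h ^+ k.+1)
  (fun k => `|(-1) ^+ k / k.+1%:R| * M ^+ k.+1)) => // [k|n|h hrho].
- exact/wienerZ/wiener_exp.
- apply: (@le_trans _ _ (series (geometric M M) n)).
    apply: ler_sum => k _; rewrite /geometric /= exprS ler_piMl ?mulr_ge0 ?exprn_ge0 //.
    by rewrite normrM normrX normrN1 expr1n mul1r normfV normr_nat invf_le1 // ler1n.
  by rewrite geometric_series_le // M0.
have Fh : `|F h| < 1 by exact: le_lt_trans (wiener_norm_le WF hrho) M1.
rewrite (_ : series _ = series (fun k => (-1) ^+ k * F h ^+ k.+1 / k.+1%:R)).
  exact: cvg_ln1D_series.
by congr series; apply/funext => k; ring.
Qed.

(** Without its constant term the series has only powers h^k with k >= 1, so shrinking the radius by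
    a factor d <= 1 shrinks the norm at least by d. *)
Lemma wiener_shrink F rho M e : wiener F rho M -> 0 < e ->
  exists2 rho', rho' <= rho & wiener (fun h => F h - F 0) rho' e.
Proof.
move=> [rho0 [a [aM aF]]] e0.
have M0 : 0 <= M by have := aM 0%N; rewrite /series /= big_geq.
(* Chosen to give both [d <= 1] and [d * M <= e]. *)
pose d := e / (M + 1 + e).
have M1e : 0 < M + 1 + e by lra.
have d0 : 0 < d by rewrite divr_gt0.
have d1 : d <= 1 by rewrite ler_pdivrMr //; lra.
have dM : d * M <= e by rewrite -mulrA ler_piMr ?(ltW e0) // ler_pdivrMl //; lra.
have drho : d * rho <= rho by rewrite ler_piMl // ltW.
have F0 : F 0 = a 0%N.
  have := aF 0; rewrite normr0 => /(_ (ltW rho0)) /(cvg_lim (@Rhausdorff R)) <-.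
  apply/cvg_lim => //; rewrite -(cvg_shiftn 1) /=; apply: cvg_near_cst.
  apply: nearW => n; rewrite /pseries /series /= addn1 big_nat_recl //= expr0 mulr1.
  by rewrite big1 ?addr0 // => k _; rewrite exprS mul0r mulr0.
exists (d * rho) => //; split; first exact: mulr_gt0.
exists (fun k => if k == 0%N then 0 else a k); split=> [[|n]|h hrho].
- by rewrite /series /= big_geq // ltW.
- rewrite /series /= big_nat_recl //= normr0 mul0r add0r.
  apply: le_trans dM.
  apply: (@le_trans _ _ (d * \sum_(0 <= k < n) `|a k.+1| * rho ^+ k.+1)).
    rewrite mulr_sumr; apply: ler_sum => k _.
    rewrite exprMn mulrCA ler_wpM2r ?mulr_ge0 ?exprn_ge0 ?(ltW rho0) //.
    by rewrite exprS ler_piMr ?(ltW d0) // exprn_ile1 // ltW.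
  rewrite ler_wpM2l ?(ltW d0) //; apply: le_trans (aM n.+1); rewrite /series /=.
  by rewrite [leRHS]big_nat_recl //= lerDr mulr_ge0.
rewrite -(cvg_shiftn 1) /=.
rewrite (_ : (fun _ => _) = (fun n => pseries a h (n + 1)%N - F 0)).
  apply: cvgB; last exact: cvg_cst.
  by rewrite (cvg_shiftn 1); apply: aF; exact: le_trans drho.
apply/funext => n; rewrite /pseries /series /= addn1 !big_nat_recl //= F0.
by rewrite expr0; ring.
Qed.

Lemma wiener_series_cvg (F : nat -> R -> R) (M : R^nat) rho N h :
  (forall j, wiener (F j) rho (M j)) -> (forall n, series M n <= N) ->
  `|h| <= rho -> cvgn (series (fun j => F j h)).
Proof.
move=> WF MN hrho; apply: normed_cvg; apply: nondecreasing_is_cvgn.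
  apply: (@nondecreasing_series _ (fun j => `|F j h|) xpredT 0) => j _ _.
  exact: normr_ge0.
exists N => _ [n _ <-]; apply: le_trans (MN n); apply: ler_sum => j _.
exact: wiener_norm_le (WF j) hrho.
Qed.

(** * Functions with such an expansion around a point *)

Definition wiener_at (f : R -> R) x := exists rho M, wiener (fun h => f (x + h)) rho M.

Lemma wiener_at_analytic f x : wiener_at f x -> analytic_at f x.
Proof.
move=> [rho [M [rho0 [a [_ af]]]]]; exists a.
near=> z; rewrite -[X in _ --> f X](subrKC x); apply: af.
rewrite distrC; near: z; exact: (cvgr_dist_le id x cvg_id rho rho0).
Unshelve. all: by end_near. Qed.

Lemma wiener_at_common f g x : wiener_at f x -> wiener_at g x -> exists rho M N,
  wiener (fun h => f (x + h)) rho M /\ wiener (fun h => g (x + h)) rho N.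
Proof.
move=> [r [M Wf]] [s [N Wg]]; exists (Num.min r s), M, N.
have r0 : 0 < r by case: Wf.
have s0 : 0 < s by case: Wg.
split; [apply: wiener_le Wf|apply: wiener_le Wg] => //; rewrite ?lt_min ?r0 //.
  by rewrite ge_min lexx.
by rewrite ge_min lexx orbT.
Qed.

Lemma wiener_at_cst c x : wiener_at (fun=> c) x.
Proof. by exists 1, `|c|; exact: wiener_cst. Qed.

Lemma wiener_atD f g x : wiener_at f x -> wiener_at g x ->
  wiener_at (fun y => f y + g y) x.
Proof.
move=> Wf /(wiener_at_common Wf)[r [M [N [WM WN]]]].
by exists r, (M + N); exact: wienerD.
Qed.

Lemma wiener_atM f g x : wiener_at f x -> wiener_at g x ->
  wiener_at (fun y => f y * g y) x.
Proof.
move=> Wf /(wiener_at_common Wf)[r [M [N [WM WN]]]].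
by exists r, (M * N); exact: wienerM.
Qed.

Lemma wiener_atX f x k : wiener_at f x -> wiener_at (fun y => f y ^+ k) x.
Proof. by move=> [r [M Wf]]; exists r, (M ^+ k); exact: wiener_exp. Qed.

Lemma wiener_at_id x : wiener_at id x.
Proof.
have W1 := wiener_cst 1 (@ltr01 R).
exists 1; eexists; apply: eq_wiener (wienerD (wiener_cst x ltr01) (wienerXM W1)).
by move=> h _; rewrite mulr1.
Qed.

(** Writes [f] as [f x] times 1 plus a function of norm at most 1/2, to which the geometric and the
    logarithm series both apply. *)
Lemma wiener_at_normalized f x : wiener_at f x -> f x != 0 -> exists rho,
  wiener (fun h => (f x)^-1 * (f (x + h) - f x)) rho 2^-1.
Proof.
move=> [r [M Wf]] fx0; have e0 : 0 < `|f x| / 2 by rewrite divr_gt0 ?normr_gt0.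
have [rho _ W] := wiener_shrink Wf e0; exists rho.
rewrite (_ : 2^-1 = `|(f x)^-1| * (`|f x| / 2)); last first.
  by rewrite normfV mulKf // normr_eq0.
by apply: wienerZ; apply: eq_wiener W => h _; rewrite addr0.
Qed.

Lemma wiener_atV f x : wiener_at f x -> f x != 0 -> wiener_at (fun y => (f y)^-1) x.
Proof.
move=> Wf fx0; have [rho W] := wiener_at_normalized Wf fx0.
have half : 2^-1 < 1 :> R by lra.
have := wienerZ (f x)^-1 (wiener_div1 (wienerZ (-1) W) _).
rewrite normrN1 mul1r => /(_ half) W'.
exists rho; eexists; apply: eq_wiener W' => h _.
rewrite -invfM; congr _^-1; rewrite mulN1r opprK mulrBr mulVf // subrKC.
by rewrite mulVKf.
Qed.

Lemma wiener_at_ln f x : wiener_at f x -> 0 < f x -> wiener_at (fun y => ln (f y)) x.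
Proof.
move=> Wf fx0; have fxn0 := lt0r_neq0 fx0.
have [rho W] := wiener_at_normalized Wf fxn0.
have half : 2^-1 < 1 :> R by lra.
have rho0 : 0 < rho by case: W.
have := wienerD (wiener_cst (ln (f x)) rho0) (wiener_ln1D W half) => W'.
exists rho; eexists; apply: eq_wiener W' => h hrho.
have /ler_normlP[] := wiener_norm_le W hrho.
set v := _ * _ => v1 v2; rewrite -lnM ?posrE //; last by lra.
by congr ln; rewrite mulrDr mulr1 /v mulVKf // subrKC.
Qed.

Lemma wiener_at_series (f : nat -> R -> R) x n :
  (forall k, wiener_at (f k) x) -> wiener_at (fun y => series (fun k => f k y) n) x.
Proof.
move=> Wf; elim: n => [|n IH].
  have [r [M W]] := wiener_at_cst 0 x.
  by exists r, M; apply: eq_wiener W => h _; rewrite /series /= big_geq.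
have [r' [M' W]] := wiener_atD IH (Wf n).
by exists r', M'; apply: eq_wiener W => h _; rewrite /series /= big_nat_recr.
Qed.

Lemma near_analytic_at (f g : R -> R) x :
  (\forall y \near x, f y = g y) -> analytic_at f x -> analytic_at g x.
Proof.
move=> fg [a af]; exists a; move: fg af; apply: filterS2 => y ->; exact.
Qed.

End Wiener.

(** * The renormalization map *)

Section Dynamics.
Context {R : realType}.
Implicit Types (x y s t : R).

Lemma corner_weights_ge x n : 0 <= x ->
  0 <= (corner_weights x n).1 /\ 1 <= (corner_weights x n).2.
Proof.
move=> x0; elim: n => //= n; case: (corner_weights x n) => a b /= [a0 b1].
have b0 : 0 <= b by lra.
have a2 := exprn_ge0 2 a0; have b2 := exprn_ge0 2 b0; have b3 := exprn_ege1 3 b1.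
have a3 := exprn_ge0 3 a0.
have ab := mulr_ge0 a0 b2; have ba := mulr_ge0 a2 b0.
split; lra.
Qed.

(* With [a] and [b] the two weights, [gap] is [a / b - 1]; the fixed point
   [a = b] is superattracting. *)
Definition gap x n : R := iter n (fun s => s ^+ 2 / (s + 4)) (x - 1).

Lemma gapS x n : gap x n.+1 = gap x n ^+ 2 / (gap x n + 4).
Proof. by []. Qed.

(** Keeps [gap x n + 2] and [gap x n + 4] positive, as the divisions and logarithms require. *)
Lemma gap_ge x n : 0 <= x -> -1 <= gap x n.
Proof.
move=> x0; elim: n => [|n IHn]; first by rewrite /gap /=; lra.
rewrite gapS ler_pdivlMr; last by lra.
by have := sqr_ge0 (gap x n); lra.
Qed.

(** A negative gap can occur only at step 0, for [x < 1]; the monotone bounds therefore start at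
    index 1. *)
Lemma gap_ge0 x n : 0 <= x -> 0 <= gap x n.+1.
Proof.
move=> x0; rewrite gapS divr_ge0 ?sqr_ge0 //.
by have := gap_ge n x0; lra.
Qed.

Lemma gap_neq0 x n : 0 <= x -> gap x n + 4 != 0.
Proof. by move=> /(gap_ge n) ?; rewrite gt_eqF //; lra. Qed.

Lemma corner_weights_gap x n : 0 <= x ->
  (corner_weights x n).1 = (corner_weights x n).2 * (gap x n + 1).
Proof.
move=> x0; elim: n => [|n IHn]; first by rewrite /gap /= mul1r subrK.
have := gap_neq0 n x0; rewrite gapS /=; move: IHn.
case: (corner_weights x n) => a b /= -> s0.
by field.
Qed.

Lemma corner_weights2S x n : 0 <= x ->
  (corner_weights x n.+1).2 =
  (corner_weights x n).2 ^+ 3 * ((gap x n + 2) * (gap x n + 4)).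
Proof.
move=> x0; have /= := corner_weights_gap n x0.
by case: (corner_weights x n) => a b /= ->; ring.
Qed.

Lemma gapS_le x n : 0 <= x -> gap x n.+1 <= gap x 1.
Proof.
move=> x0; elim: n => // n; apply: le_trans.
have g0 := gap_ge0 n x0; rewrite gapS ler_pdivrMr; last by lra.
by rewrite expr2 ler_wpM2l //; lra.
Qed.

Lemma gap_ratio_le s t : 0 <= s -> s <= t -> s / (s + 4) <= t / (t + 4).
Proof.
move=> s0 st; rewrite ler_pdivrMr; last by lra.
rewrite mulrAC ler_pdivlMr; last by lra.
by rewrite !mulrDr [t * s]mulrC lerD2l; lra.
Qed.

(** Each step multiplies the gap s by s / (s + 4), which increases with s and so is largest at the
    first nonnegative gap, [gap x 1]. *)
Lemma gap_geometric x n : 0 <= x ->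
  gap x n.+1 <= gap x 1 * (gap x 1 / (gap x 1 + 4)) ^+ n.
Proof.
move=> x0; elim: n => [|n IHn]; first by rewrite expr0 mulr1.
have g0 := gap_ge0 n x0.
rewrite exprSr mulrA [leLHS]gapS expr2 -[leLHS]mulrA; apply: ler_pM => //.
  by rewrite divr_ge0 // addr_ge0.
by apply: gap_ratio_le => //; exact: gapS_le.
Qed.

Lemma gap_small x e : 0 <= x -> 0 < e -> exists K, `|gap x K| <= e.
Proof.
move=> x0 e0; have g1 := gap_ge0 0 x0.
have : `|gap x 1 / (gap x 1 + 4)| < 1.
  move: (gap x 1) g1 => g g0; rewrite ger0_norm ?divr_ge0 ?addr_ge0 //.
  by rewrite ltr_pdivrMr; lra.
move=> /(cvg_geometric (gap x 1))/cvgrPdist_le/(_ e e0)[K _ /(_ K (leqnn K))].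
rewrite sub0r normrN => HK; exists K.+1; apply: le_trans HK.
by rewrite ger0_norm ?gap_ge0 // (le_trans (gap_geometric K x0)) // ler_norm.
Qed.

(** The difference of consecutive values of 3^-n ln b_n, by b_(n+1) = b_n^3 (s_n + 2)(s_n + 4). *)
Definition increment x n := 3^-1 ^+ n.+1 * ln ((gap x n + 2) * (gap x n + 4)).

Lemma increment_pos x n : 0 <= x -> 0 < (gap x n + 2) * (gap x n + 4).
Proof. by move=> /(gap_ge n) ?; rewrite mulr_gt0 //; lra. Qed.

Lemma series_increment x n : 0 <= x ->
  3^-1 ^+ n * ln (corner_weights x n).2 = series (increment x) n.
Proof.
move=> x0; elim: n => [|n IHn]; first by rewrite ln1 mulr0 /series /= big_geq.
rewrite (_ : series _ n.+1 = series (increment x) n + increment x n); last first.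
  by rewrite /series /= big_nat_recr.
rewrite -IHn corner_weights2S //.
have b0 : 0 < (corner_weights x n).2.
  by have [_] := corner_weights_ge n x0; exact: lt_le_trans.
rewrite lnM ?posrE ?exprn_gt0 ?increment_pos // lnXn // mulrDr; congr (_ + _).
by rewrite exprS -mulr_natr; field.
Qed.

Lemma wiener_at_gap y n : wiener_at (fun y => gap (y ^+ 4) n) y.
Proof.
have y0 : 0 <= y ^+ 4 by rewrite exprn_even_ge0.
elim: n => [|n IHn].
  by apply: wiener_atD; [apply: wiener_atX; exact: wiener_at_id|exact: wiener_at_cst].
apply: wiener_atM; first exact: wiener_atX.
apply: wiener_atV; last exact: gap_neq0.
by apply: wiener_atD => //; exact: wiener_at_cst.
Qed.

Lemma wiener_at_increment y n : wiener_at (fun y => increment (y ^+ 4) n) y.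
Proof.
apply: wiener_atM; first exact: wiener_at_cst.
apply: (@wiener_at_ln _ (fun y => (gap (y ^+ 4) n + 2) * (gap (y ^+ 4) n + 4))).
  by apply: wiener_atM; apply: wiener_atD; (exact: wiener_at_gap || exact: wiener_at_cst).
by apply: increment_pos; rewrite exprn_even_ge0.
Qed.

(** Since F^2 / (F + 4) = (1/4) F^2 / (1 + F/4), the new norm is at most (1/4) / (1 - 1/4) = 1/3, on
    the same radius. *)
Lemma wiener_gap_step F rho : @wiener R F rho 1 ->
  wiener (fun h => F h ^+ 2 / (F h + 4)) rho 1.
Proof.
move=> WF; have rho0 : 0 < rho by case: WF.
have q : `|- 4^-1| * 1 < 1 :> R by rewrite normrN ger0_norm //; lra.
have W := wiener_div1 (wienerZ (- 4^-1) WF) q.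
have := wienerZ 4^-1 (wienerM (wiener_exp 2 WF) W).
have -> : `|4^-1| * (1 ^+ 2 * (1 - `|- 4^-1| * 1)^-1) = 3^-1 :> R.
  by rewrite normrN ger0_norm //; field.
move=> W'; apply: (@wiener_le _ _ rho _ 3^-1) => //; first by lra.
apply: eq_wiener W' => h _; rewrite mulrCA; congr (_ * _).
by rewrite -invfM; congr _^-1; field.
Qed.

(** Factor (F + 2)(F + 4) = 8 (1 + F/2)(1 + F/4); the two logarithms have norm at most 1 and 1/3. *)
Lemma wiener_ln_gap F rho : @wiener R F rho 1 ->
  wiener (fun h => ln ((F h + 2) * (F h + 4))) rho (`|ln 8| + (1 + 3^-1)).
Proof.
move=> WF; have rho0 : 0 < rho by case: WF.
have h2 : `|2^-1| * 1 < 1 :> R by rewrite ger0_norm //; lra.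
have h4 : `|4^-1| * 1 < 1 :> R by rewrite ger0_norm //; lra.
have := wienerD (wiener_cst (ln 8) rho0)
  (wienerD (wiener_ln1D (wienerZ 2^-1 WF) h2) (wiener_ln1D (wienerZ 4^-1 WF) h4)).
have -> : `|2^-1| * 1 / (1 - `|2^-1| * 1) = 1 :> R by rewrite ger0_norm //; field.
have -> : `|4^-1| * 1 / (1 - `|4^-1| * 1) = 3^-1 :> R by rewrite ger0_norm //; field.
apply: eq_wiener => h hrho; have /ler_normlP[F1 F2] := wiener_norm_le WF hrho.
rewrite -!lnM ?posrE ?mulr_gt0 //; try lra.
by congr ln; field.
Qed.

(** At a late step [K] the value at [y] is at most 1/2, and a small radius brings the rest of the
    expansion below 1/2. From norm 1 on, the recursion costs no radius. *)
Lemma wiener_gap_tail y : exists rho K,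
  forall j, wiener (fun h => gap ((y + h) ^+ 4) (K + j)) rho 1.
Proof.
have y0 : 0 <= y ^+ 4 by rewrite exprn_even_ge0.
have half : 0 < 2^-1 :> R by lra.
have [K HK] := gap_small y0 half.
have [r [M W]] := wiener_at_gap y K.
have [rho _ W'] := wiener_shrink W half.
have rho0 : 0 < rho by case: W'.
exists rho, K; elim=> [|j IHj]; last by rewrite addnS; exact: wiener_gap_step.
have := wienerD W' (wiener_cst (gap (y ^+ 4) K) rho0) => {}W.
apply: (@wiener_le _ _ rho _ (2^-1 + `|gap (y ^+ 4) K|)) => //; first by lra.
by apply: eq_wiener W => h _; rewrite addn0 addr0 subrK.
Qed.

(** The limit of 3^-n ln b_n, with b_n the second corner weight. *)
Definition growth x : R := limn (series (increment x)).

Lemma growth_split x K : cvgn (series (fun j => increment x (K + j))) ->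
  series (increment x) @ \oo -->
  series (increment x) K + limn (series (fun j => increment x (K + j))).
Proof.
move=> c; rewrite -(cvg_shiftn K) /=.
rewrite (_ : (fun _ => _) = (fun n => series (increment x) K +
    series (fun j => increment x (K + j)) n)).
  by apply: cvgD; [exact: cvg_cst|exact: c].
apply/funext => n; rewrite /series /= (@big_cat_nat _ _ _ K) ?leq_addl //=.
congr (_ + _); rewrite -{1}[K]add0n big_addn addnK.
by apply: eq_bigr => i _; rewrite addnC.
Qed.

Lemma growth_wiener y : exists rho K N, 0 < rho /\
  wiener (fun h => limn (series (fun j => increment ((y + h) ^+ 4) (K + j)))) rho N /\
  forall h, `|h| <= rho -> cvgn (series (fun j => increment ((y + h) ^+ 4) (K + j))).
Proof.
have [rho [K W]] := wiener_gap_tail y.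
have rho0 : 0 < rho by case: (W 0%N).
pose C : R := `|ln 8| + (1 + 3^-1).
have C0 : 0 <= C by rewrite addr_ge0 //; lra.
have Wi j := wienerZ (3^-1 ^+ (K + j).+1) (wiener_ln_gap (W j)).
(* The logarithms are bounded by the same [C] for all [j], so the factors 3^-(K+j+1) make the norms
   summable. *)
have sumle n : series (fun j => `|3^-1 ^+ (K + j).+1| * C) n <= C / (1 - 3^-1).
  apply: le_trans (geometric_series_le n C0 _); last by lra.
  apply: ler_sum => j _; rewrite /geometric /= mulrC ler_wpM2l //.
  rewrite ger0_norm ?exprn_ge0 // -addnS exprD exprS mulrCA mulrA.
  by rewrite ler_piMl ?exprn_ge0 // mulr_ile1 ?exprn_ge0 ?exprn_ile1 //; lra.
exists rho, K, (C / (1 - 3^-1)); split=> //; have cv h := wiener_series_cvg Wi sumle.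
split=> [|h hrho]; last exact: cv.
by apply: (wiener_series rho0 Wi sumle) => h hrho; exact: cv.
Qed.

Lemma cvg_growth y : series (increment (y ^+ 4)) @ \oo --> growth (y ^+ 4).
Proof.
have [rho [K [N [rho0 [_ cv]]]]] := growth_wiener y.
have := cv 0; rewrite normr0 addr0 => /(_ (ltW rho0))/growth_split c.
by apply: cvgP c.
Qed.

(** The first [K] terms are finitely many, each with its own radius; the tail has a common one. *)
Lemma wiener_at_growth y : wiener_at (fun y => growth (y ^+ 4)) y.
Proof.
have [rho [K [N [rho0 [W cv]]]]] := growth_wiener y.
have Wt : wiener_at (fun z =>
    limn (series (fun j => increment (z ^+ 4) (K + j)))) y by exists rho, N.
have [r [M W']] := wiener_atD (wiener_at_series K (wiener_at_increment y)) Wt.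
have m0 : 0 < Num.min rho r by rewrite lt_min rho0; case: W'.
exists (Num.min rho r), M.
apply: eq_wiener (wiener_le m0 _ (lexx M) W') => [h|]; last first.
  by rewrite ge_min lexx orbT.
rewrite le_min => /andP[hrho _]; apply/esym/cvg_lim => //.
exact: growth_split (cv h hrho).
Qed.

End Dynamics.

(** * The pressure *)

Section PressureLimit.
Context {R : realType}.
Implicit Types (x y t : R).

Definition total_weight x n : R := (corner_weights x n).1 + 3 * (corner_weights x n).2.

Lemma total_weight_ge x n : 0 <= x -> 3 <= total_weight x n.
Proof. by move=> /(corner_weights_ge n)[]; rewrite /total_weight; lra. Qed.

(** Both bounds propagate by cubing from their values x and x + 3 at n = 0. The lower one is carried
    by the first weight alone, whose recursion contains the term a^3. *)
Lemma total_weight_bounds x n : 0 <= x ->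
  x ^+ (3 ^ n) <= total_weight x n <= (x + 3) ^+ (3 ^ n).
Proof.
move=> x0; suff : x ^+ (3 ^ n) <= (corner_weights x n).1 /\
    total_weight x n <= (x + 3) ^+ (3 ^ n).
  move=> [lo hi]; rewrite hi andbT (le_trans lo) // /total_weight lerDl.
  by have [_] := corner_weights_ge n x0; lra.
elim: n => [|n]; first by rewrite /total_weight /= !expr1 mulr1.
have := corner_weights_ge n x0; have := total_weight_ge n x0.
rewrite expnSr !exprM /total_weight /=.
case: (corner_weights x n) => a b /= z3 [a0 b1] [lo hi].
have x0' := exprn_ge0 (3 ^ n) x0; have b0 : 0 <= b by lra.
have a2 := exprn_ge0 2 a0; have b2 := exprn_ge0 2 b0; have b3 := exprn_ge0 3 b0.
have ab := mulr_ge0 a0 b2; have ba := mulr_ge0 a2 b0.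
split.
  apply: (@le_trans _ _ (a ^+ 3)); first by rewrite lerXn2r ?nnegrE.
  by lra.
apply: (@le_trans _ _ ((a + 3 * b) ^+ 3)); last by rewrite lerXn2r ?nnegrE //; lra.
rewrite -subr_ge0 (_ : _ - _ =
  6 * (a ^+ 2 * b) + 12 * (a * b ^+ 2) + 14 * b ^+ 3); [lra|ring].
Qed.

(** The total weight is b_n (s_n + 4), and 3^-n ln (s_n + 4) tends to 0 because the gaps are
    bounded. *)
Lemma cvg_growth_total_weight y :
  3^-1 ^+ n * ln (total_weight (y ^+ 4) n) @[n --> \oo] --> growth (y ^+ 4).
Proof.
have x0 : 0 <= y ^+ 4 by rewrite exprn_even_ge0.
rewrite (_ : (fun n => _) = (fun n => series (increment (y ^+ 4)) n +
    3^-1 ^+ n * ln (gap (y ^+ 4) n + 4))); last first.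
  apply/funext => n; rewrite -series_increment // -mulrDr -lnM ?posrE.
  - by rewrite /total_weight corner_weights_gap //; congr (_ * ln _); ring.
  - by have [_] := corner_weights_ge n x0; exact: lt_le_trans.
  - by have := gap_ge n x0; lra.
rewrite -[X in _ --> X]addr0; apply: cvgD; first exact: cvg_growth.
rewrite -(cvg_shiftn 1) /=.
pose B := gap (y ^+ 4) 1 + 4.
have cB : 3^-1 ^+ n * B @[n --> \oo] --> 0 * B.
  by apply: cvgM; [apply: cvg_expr; rewrite ger0_norm //; lra | exact: cvg_cst].
rewrite mul0r in cB; apply: squeeze_cvgr (cvg_cst 0) cB; apply: nearW => n.
have g0 := gap_ge0 n x0; have gB := gapS_le n x0.
have p0 : 0 <= 3^-1 ^+ n :> R by rewrite exprn_ge0.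
have l0 : 0 <= ln (gap (y ^+ 4) n.+1 + 4) by rewrite ln_ge0 //; lra.
have l1 : ln (gap (y ^+ 4) n.+1 + 4) < gap (y ^+ 4) n.+1 + 4.
  by rewrite ln_sublinear //; lra.
rewrite addn1 mulr_ge0 ?exprn_ge0 //= ler_pM ?exprn_ge0 //; last by rewrite /B; lra.
by rewrite exprS ler_piMl //; lra.
Qed.

(** The bounds on the total weight give ln x and ln (x + 3) for x = y^4 at every n; the last term is
    ln (1 + t) <= t with t = 3 / y^4. *)
Lemma growth_bounds y : 0 < y ->
  4 * ln y <= growth (y ^+ 4) <= 4 * ln y + 3 * y^-1 ^+ 4.
Proof.
move=> y0; have x0 : 0 < y ^+ 4 by rewrite exprn_gt0.
have Zb n := total_weight_bounds n (ltW x0).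
have p0 n : 0 < 3^-1 ^+ n :> R by rewrite exprn_gt0.
have lnp n (z : R) : 0 < z -> 3^-1 ^+ n * ln (z ^+ (3 ^ n)) = ln z.
  move=> z0; rewrite lnXn // -[ln z *+ _]mulr_natl mulrA natrX -exprMn.
  by rewrite mulVf ?expr1n ?mul1r.
have Zp n : 0 < total_weight (y ^+ 4) n by have := total_weight_ge n (ltW x0); lra.
have cG := @cvg_growth_total_weight y.
apply/andP; split.
  rewrite (_ : 4 * ln y = ln (y ^+ 4)); last by rewrite lnXn // mulr_natl.
  rewrite -(cvg_lim _ cG) //; apply: limr_ge; first exact: cvgP cG.
  apply: nearW => n.
  rewrite -[leLHS](lnp n) // ler_pM2l // ler_ln ?posrE ?exprn_gt0 //.
  by case/andP: (Zb n).
have x3 : 0 < y ^+ 4 + 3 by lra.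
apply: (@le_trans _ _ (ln (y ^+ 4 + 3))).
  rewrite -(cvg_lim _ cG) //; apply: limr_le; first exact: cvgP cG.
  apply: nearW => n.
  rewrite -[leRHS](lnp n) // ler_pM2l // ler_ln ?posrE ?exprn_gt0 //.
  by case/andP: (Zb n).
rewrite (_ : y ^+ 4 + 3 = y ^+ 4 * (1 + 3 * y^-1 ^+ 4)); last by field; rewrite gt_eqF.
have i0 : 0 < y^-1 ^+ 4 by rewrite exprn_gt0 ?invr_gt0.
rewrite lnM ?posrE //; last by lra.
rewrite lnXn // -[ln y *+ _]mulr_natl lerD2l le_ln1Dx //; lra.
Qed.

(** * From the partition function to the pressure *)

Lemma cvg_exprz (m : int) y : y != 0 -> t ^ m @[t --> y] --> y ^ m.
Proof.
move=> y0; case: m => k; first exact: exprn_continuous.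
by apply: cvgV; [rewrite expf_neq0 | exact: exprn_continuous].
Qed.

Lemma cvg_Z n y : y != 0 -> Z n t @[t --> y^'] --> Z n y.
Proof.
move=> y0; apply: (@cvg_within_filter _ _ _ (nbhs y)).
by apply: cvg_big => [|sigma _]; [exact: add_continuous|exact: cvg_exprz].
Qed.

Lemma ZE n y : y != 0 -> Z n y = 2 * y ^- (3 ^ n) * total_weight (y ^+ 4) n.
Proof. by move=> y0; exact: Z_corner_weights. Qed.

Lemma absZ_pos n y : 0 < y -> absZ n y = (Z n y)%:E.
Proof.
move=> y0; apply/cvg_lim => //; apply: cvg_EFin; first by apply: nearW.
rewrite -[X in _ --> X]ger0_norm.
  by apply: cvg_norm; apply: cvg_Z; rewrite gt_eqF.
rewrite ZE ?gt_eqF // mulr_ge0 ?mulr_ge0 ?invr_ge0 ?exprn_ge0 ?(ltW y0) //.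
by apply: le_trans (total_weight_ge n _) => //; rewrite exprn_ge0 ?ltW.
Qed.

Lemma absZ0 n : absZ n (0 : R) = +oo%E.
Proof.
apply/cvg_lim => //; apply/cvgeyPge => A.
near=> t.
have t0 : t != 0 by near: t; exact: nbhs_dnbhs_neq.
have x0 : 0 <= t ^+ 4 by rewrite exprn_even_ge0.
have w3 := total_weight_ge n x0.
have nt0 : 0 < `|t| by rewrite normr_gt0.
(* This radius ensures at once [|t| <= 1] and [1 / |t| >= A]. As the total weight is at least 3, the
   pole is not cancelled. *)
have nt1 : `|t| <= (1 + `|A|)^-1.
  near: t; apply: dnbhs0_le; rewrite invr_gt0 ltr_pwDl //.
have A0 : 0 < 1 + `|A| by rewrite ltr_pwDl.
have t1 : `|t| <= 1 by rewrite (le_trans nt1) // invf_le1 // lerDl.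
rewrite lee_fin ZE // !normrM normfV normrX (ger0_norm (ler0n _ 2)).
rewrite [`|total_weight _ _|]ger0_norm; last by lra.
apply: (@le_trans _ _ (`|t| ^- (3 ^ n))).
  apply: (@le_trans _ _ `|t|^-1).
    have : 1 + `|A| <= `|t|^-1.
      by rewrite -[leLHS]invrK lef_pV2 ?posrE ?invr_gt0.
    by have := ler_norm A; lra.
  by rewrite lef_pV2 ?posrE ?exprn_gt0 // ler_iXnr // expn_gt0.
have v0 : 0 < `|t| ^- (3 ^ n) by rewrite invr_gt0 exprn_gt0.
rewrite -mulrA mulrCA ler_peMr ?(ltW v0) //; lra.
Unshelve. all: by end_near. Qed.

(** The pole factor y^(-3^n) contributes exactly -ln y after normalization, and the factor 2 a
    vanishing term. *)
Lemma pressure_seq_pos y n : 0 < y -> pressure_seq y n =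
  (4^-1 * (3^-1 ^+ n * ln 2 + 3^-1 ^+ n * ln (total_weight (y ^+ 4) n) - ln y))%:E.
Proof.
move=> y0; have x0 : 0 <= y ^+ 4 by rewrite exprn_ge0 // ltW.
have w3 := total_weight_ge n x0.
have v0 : 0 < y ^+ (3 ^ n) by rewrite exprn_gt0.
have Zp : 0 < Z n y.
  by rewrite ZE ?gt_eqF // !mulr_gt0 ?invr_gt0 //; lra.
rewrite /pressure_seq absZ_pos // lne_EFin // -EFinM; congr EFin.
rewrite ZE ?gt_eqF // !lnM ?posrE ?mulr_gt0 ?invr_gt0 //; try lra.
rewrite lnV ?posrE // lnXn // -[ln y *+ _]mulr_natr natrX exprVn.
by field; rewrite expf_neq0.
Qed.

Lemma cvg_pressure_seq_pos y : 0 < y ->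
  pressure_seq y @ \oo --> (4^-1 * (growth (y ^+ 4) - ln y))%:E.
Proof.
move=> y0; rewrite (eq_cvg _ _ (fun n => pressure_seq_pos n y0)).
apply: cvg_EFin; first exact: nearW.
apply: cvgM; first exact: cvg_cst.
apply: cvgB; last exact: cvg_cst.
rewrite -[X in _ --> X]add0r -[X in X + _](mul0r (ln 2)); apply: cvgD.
  by apply: cvgM; [apply: cvg_expr; rewrite ger0_norm //; lra | exact: cvg_cst].
exact: cvg_growth_total_weight.
Qed.

Lemma pressure_pos y : 0 < y -> pressure y = (4^-1 * (growth (y ^+ 4) - ln y))%:E.
Proof. by move=> /cvg_pressure_seq_pos/cvg_lim; apply. Qed.

Lemma pressure_seq0 : pressure_seq (0 : R) = cst +oo%E.
Proof.
by apply/funext => n; rewrite /pressure_seq absZ0 /= gt0_muley.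
Qed.

End PressureLimit.

(* At y = 0 the pole of Z_n (of order 3 ^ n) makes the pressure infinite, with
   singular part - (1/4) log y; analyticity up to the endpoint 0 of [0, +oo[
   means that the remainder is analytic there. *)
Theorem theorem1p1 (R : realType) :
  [/\ (forall y : R, 0 <= y -> cvgn (pressure_seq y)),
      (forall y : R, 0 < y ->
         pressure y \is a fin_num /\ analytic_at (fine \o @pressure R) y),
      (pressure (0 : R) = +oo%E /\
       exists2 g : R -> R, analytic_at g 0 &
         \forall y \near (0 : R)^'+, pressure y = (g y - 4^-1 * ln y)%:E) &
      `|fine (pressure y) - 3 / 4 * ln y| @[y --> +oo%R] --> (0 : R)].
Proof.
split.
- move=> y; rewrite le_eqVlt => /predU1P[<-|y0].
    by rewrite pressure_seq0; exact: is_cvg_cst.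
  by apply: cvgP; exact: cvg_pressure_seq_pos.
- move=> y y0; split; first by rewrite pressure_pos.
  apply: (@near_analytic_at _ (fun z => 4^-1 * (growth (z ^+ 4) + -1 * ln z))).
    near=> z; rewrite /= pressure_pos /= ?mulN1r //.
    by near: z; exact: lt_nbhsr.
  apply: wiener_at_analytic; apply: wiener_atM; first exact: wiener_at_cst.
  apply: wiener_atD; first exact: wiener_at_growth.
  apply: wiener_atM; first exact: wiener_at_cst.
  by apply: (@wiener_at_ln _ id) => //; exact: wiener_at_id.
- split; first by rewrite /pressure pressure_seq0; exact: lim_cst.
  (* Removing the singular part leaves [growth] at z^4, which has an expansion at every real point,
     0 included. *)
  exists (fun z => 4^-1 * growth (z ^+ 4)).
    apply: wiener_at_analytic; apply: wiener_atM; first exact: wiener_at_cst.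
    exact: wiener_at_growth.
  near=> y; rewrite pressure_pos ?mulrBr //.
(* By [growth_bounds] the difference lies between 0 and (3/4) y^-4, which is at most 1/y for y >=
   1. *)
apply: (@squeeze_cvgr _ _ _ _ (fun=> 0) (fun y : R => y^-1)); last 2 first.
- exact: cvg_cst.
- by apply/gtr0_cvgV0; [exact: nbhs_pinfty_gt|exact: cvg_id].
near=> y.
have y1 : 1 <= y by near: y; exact: nbhs_pinfty_ge.
have y0 : 0 < y by lra.
rewrite pressure_pos // normr_ge0 /=.
have /andP[lo hi] := growth_bounds y0.
have i0 : 0 < y^-1 by rewrite invr_gt0.
have i1 : y^-1 ^+ 4 <= y^-1 by rewrite ler_iXnr ?(ltW i0) // invf_le1.
rewrite ger0_norm; lra.
Unshelve. all: by end_near. Qed.
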